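(* (a) Let $p$ be a prime, $n\ge1$, $V$ an elementary abelian $p$-group of order $p^n$ (written additively), $k>1$, and $C$ a cyclic group of order $k$ generated by $x$. Let $A,A'\in\mathrm{Aut}(V)$ be commuting automorphisms whose orders $o(A),o(A')$ divide $\gcd(k,p^n-1)$, with $A\neq1$; let $u_0\in V$ and $v_1=u_0-Au_0$. Assume: if $A'=1$ and $v_1=0$ then $k=o(A)$; if $A'=1$ and $v_1\ne0$ then $k=p\,o(A)$; if $A'\neq1$ then $k=\mathrm{lcm}(o(A),o(A'))$. Assume also that $V$ is a simple module over the subring $\mathcal{R}$ of $\mathrm{End}(V)$ generated by $A$ and $A'$. Let $(B,+)=V\rtimes C$ with $x+v-x=Av$; write each $a\in B$ uniquely as $a=v+ix$ ($v\in V$, $0\le i<k$) and set $|a|=i$. Define $\lambda\colon B\to B$ by $\lambda(v+ix)=A'v+u_0-A^iu_0+ix$ and $a\circ b=a+\lambda^{|a|}(b)$. Then $(B,+,\circ)$ is a skew left brace, and the set $X=\{v+x-v:v\in V\}$ satisfies $X=V+x$ and $r_B(X\times X)=X\times X$; the restriction $r=r_B|_{X\times X}$ is a finite non-degenerate irretractable simple solution, given by $$r(v+x,w+x)=\big(A'w+v_1+x,\;-A^{-1}w+(AA')^{-1}(v-v_1)+w+x\big)\quad(v,w\in V).$$ (b) Conversely, let $B$ be a finite skew left brace and $X\subseteq B$ satisfying the standing assumptions below, with $V$ abelian. Fix $x\in X$, let $k=|B/V|$, $Av=x+v-x$, $A'=\lambda_x|_V$, and choose $u_0\in V$ with $\lambda_x(x)=u_0+x-u_0$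 (such $u_0$ exists). Then $k>1$, $V$ is elementary abelian of order $p^n$ for some prime $p$ and $n\ge1$, $x$ has additive order $k$ and $(B,+)=V\rtimes\langle x\rangle_+$, all hypotheses of (a) hold for $V,k,A,A',u_0$, and $\lambda_a=\lambda_x^{|a|}$ for all $a\in B$ with $\lambda_x(v+ix)=A'v+u_0-A^iu_0+ix$; so $B$ and $(X,r_B|_{X\times X})$ are exactly as constructed in (a).
   Context: Skew left brace $(B,+,\circ)$: groups $(B,+)$, $(B,\circ)$ with $a\circ(b+c)=a\circ b-a+a\circ c$; $\lambda_a(b)=-a+a\circ b$, $\sigma_a(b)=-a+b+a$, $a*b=-a+a\circ b-b$, $a^{-1}$ the $\circ$-inverse. Ideal: normal subgroup $I$ of $(B,+)$, $\lambda_a(I)\subseteq I$ for all $a$, normal in $(B,\circ)$. $B^{(2)}=B*B$, $B^{(3)}=B^{(2)}*B$ (additive subgroups generated by the corresponding $*$-products). Associated solution $r_B(a,b)=(\lambda_a(b),\lambda_a(b)^{-1}\circ a\circ b)$. A solution $(X,r)$ (writing $r(x,y)=(\lambda_x(y),\rho_y(x))$) is non-degenerate if $r$ and all $\lambda_x,\rho_y$ are bijective; irretractable if $x\mapsto(\lambda_x,\rho_x)$ is injective; simple if $|X|>1$ and every surjective morphism of solutions $(X,r)\to(Y,s)$ (maps $f$ with $(f\times f)r=s(f\times f)$) is bijective or has $|Y|=1$. Standing assumptions for (b): $X\subseteq B$, $|X|\ge3$, $\lambda_a(X)=X$ and $\sigma_a(X)=X$ for all $a\in B$; $B$ additively generated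 by $X$; the ideal $V$ generated by $\{x-y:x,y\in X\}$ is the smallest non-zero ideal of $B$; $B/V$ is a trivial skew left brace with cyclic additive group; the group $\{\sigma_a\lambda_b|_X:a,b\in V\}$ acts transitively on $X$; $B^{(3)}=0$; and $(X,r_B|_{X\times X})$ is simple. *)

(* Defs.v *)
From HB Require Import structures.
From mathcomp Require Import all_boot.

Set Implicit Arguments.
Unset Strict Implicit.
Unset Printing Implicit Defensive.

Definition is_group (T : Type) (op : T -> T -> T) (e : T) (inv : T -> T) : Prop :=
  [/\ associative op, left_id e op, right_id e op &
      forall a, op (inv a) a = e /\ op a (inv a) = e].

Definition is_skew_brace (T : Type) (add : T -> T -> T) (zero : T) (opp : T -> T)
    (circ : T -> T -> T) (one : T) (inv : T -> T) : Prop :=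
  [/\ is_group add zero opp, is_group circ one inv &
      forall a b c, circ a (add b c) = add (add (circ a b) (opp a)) (circ a c)].

Section Brace.
Variables (T : finType) (add : T -> T -> T) (zero : T) (opp : T -> T)
          (circ : T -> T -> T) (inv : T -> T).

Definition blam (a b : T) : T := add (opp a) (circ a b).
Definition bsigma (a b : T) : T := add (add (opp a) b) a.
Definition bstar (a b : T) : T := add (add (opp a) (circ a b)) (opp b).
Definition brB (ab : T * T) : T * T :=
  let l := blam ab.1 ab.2 in (l, circ (circ (inv l) ab.1) ab.2).

Definition is_addsubgroup (H : {set T}) : bool :=
  [&& zero \in H, [forall a in H, forall b in H, add a b \in H] &
      [forall a in H, opp a \in H]].

Definition add_gen (S : {set T}) : {set T} :=
  [set a | [forall H : {set T}, (is_addsubgroup H && (S \subset H)) ==> (a \in H)]].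

Definition is_ideal (I : {set T}) : bool :=
  [&& is_addsubgroup I,
      [forall a in I, forall b, add (add b a) (opp b) \in I],
      [forall a in I, forall b, blam b a \in I] &
      [forall a in I, forall b, circ (circ b a) (inv b) \in I]].

Definition ideal_gen (S : {set T}) : {set T} :=
  [set a | [forall I : {set T}, (is_ideal I && (S \subset I)) ==> (a \in I)]].

Definition B2 : {set T} := add_gen [set bstar a b | a in [set: T], b in [set: T]].
Definition B3 : {set T} := add_gen [set bstar c d | c in B2, d in [set: T]].

End Brace.

Section YBE.
Variables (Y : Type) (s : Y * Y -> Y * Y).
Definition r12 (t : Y * Y * Y) : Y * Y * Y :=
  let: (a, b, c) := t in ((s (a, b)).1, (s (a, b)).2, c).
Definition r23 (t : Y * Y * Y) : Y * Y * Y :=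
  let: (a, b, c) := t in (a, (s (b, c)).1, (s (b, c)).2).
Definition ybe : Prop := forall t, r12 (r23 (r12 t)) = r23 (r12 (r23 t)).
End YBE.

Section Solutions.
Variables (T : finType) (X : {set T}) (r : T * T -> T * T).

Definition sol_lam (a b : T) : T := (r (a, b)).1.
Definition sol_rho (b a : T) : T := (r (a, b)).2.

Definition solution_on : Prop :=
  (forall a b, a \in X -> b \in X -> r (a, b) \in setX X X) /\
  (forall a b c, a \in X -> b \in X -> c \in X ->
     r12 r (r23 r (r12 r (a, b, c))) = r23 r (r12 r (r23 r (a, b, c)))).

Definition nondegenerate_on : Prop :=
  [/\ {in setX X X &, injective r}, r @: setX X X = setX X X,
      forall a, a \in X -> {in X &, injective (sol_lam a)} /\ sol_lam a @: X = X &
      forall b, b \in X -> {in X &, injective (sol_rho b)} /\ sol_rho b @: X = X].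

Definition irretractable_on : Prop :=
  forall a b, a \in X -> b \in X ->
    (forall c, c \in X -> sol_lam a c = sol_lam b c /\ sol_rho a c = sol_rho b c) ->
    a = b.

Definition simple_on : Prop :=
  1 < #|X| /\
  forall (Y : Type) (s : Y * Y -> Y * Y) (f : T -> Y),
    ybe s ->
    (forall y, exists2 a, a \in X & f a = y) ->
    (forall a b, a \in X -> b \in X ->
       s (f a, f b) = (f (r (a, b)).1, f (r (a, b)).2)) ->
    {in X &, injective f} \/ (forall y1 y2 : Y, y1 = y2).

End Solutions.

Section HypA.
Variables (G : finType) (add : G -> G -> G) (zero : G) (opp : G -> G)
          (V : {set G}).

Definition elem_abelian (p n : nat) : Prop :=
  [/\ prime p, 0 < n, is_addsubgroup add zero opp V,
      (forall v w, v \in V -> w \in V -> add v w = add w v) &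
      #|V| = p ^ n /\ (forall v, v \in V -> iter p (add v) zero = zero)].

Definition is_aut_on (f : G -> G) : Prop :=
  [/\ {in V &, injective f}, f @: V = V &
      forall v w, v \in V -> w \in V -> f (add v w) = add (f v) (f w)].

Definition order_on (f : G -> G) (m : nat) : Prop :=
  [/\ 0 < m, forall v, v \in V -> iter m f v = v &
      forall j, 0 < j < m -> exists2 v, v \in V & iter j f v != v].

Definition is_id_on (f : G -> G) : Prop := forall v, v \in V -> f v = v.

(* V is a simple module over the subring of End(V) generated by A and A'
   (R-submodules = additive subgroups invariant under A and A') *)
Definition simple_module_on (A A' : G -> G) : Prop :=
  V != [set zero] /\
  forall W : {set G}, W \subset V -> is_addsubgroup add zero opp W ->
    A @: W \subset W -> A' @: W \subset W -> W = [set zero] \/ W = V.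

Definition hypA (p n k : nat) (A A' : G -> G) (u0 : G) : Prop :=
  let v1 := add u0 (opp (A u0)) in
  [/\ elem_abelian p n /\ 1 < k,
      is_aut_on A /\ is_aut_on A' /\ (forall v, v \in V -> A (A' v) = A' (A v)),
      u0 \in V /\ ~ is_id_on A,
      (exists oA oA',
         [/\ order_on A oA, order_on A' oA',
             oA %| gcdn k (p ^ n - 1), oA' %| gcdn k (p ^ n - 1) &
             [/\ is_id_on A' -> v1 = zero -> k = oA,
                 is_id_on A' -> v1 <> zero -> k = p * oA &
                 ~ is_id_on A' -> k = lcmn oA oA']]) &
      simple_module_on A A'].

Definition add_order (x : G) (k : nat) : Prop :=
  [/\ 0 < k, iter k (add x) zero = zero &
      forall j, 0 < j < k -> iter j (add x) zero <> zero].

Definition sdp_decomp (x : G) (k : nat) : Prop :=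
  (forall a, exists v i, [/\ v \in V, i < k & a = add v (iter i (add x) zero)]) /\
  (forall v w i j, v \in V -> w \in V -> i < k -> j < k ->
     add v (iter i (add x) zero) = add w (iter j (add x) zero) -> v = w /\ i = j).

End HypA.

(* The construction of part (a): B = V x| C on the type V * 'I_k,      *)
(* the pair (v, i) standing for v + i x.                               *)

Lemma ord_pos (k : nat) (i : 'I_k) : 0 < k.
Proof. exact: leq_ltn_trans (leq0n i) (ltn_ord i). Qed.

Definition zk_add (k : nat) (i j : 'I_k) : 'I_k :=
  Ordinal (ltn_pmod (i + j) (ord_pos i)).

Section SDP.
Variables (VT : finType) (addV : VT -> VT -> VT) (oppV : VT -> VT)
          (A A' : VT -> VT) (u0 : VT) (k : nat).

Definition sdp_add (a b : VT * 'I_k) : VT * 'I_k :=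
  (addV a.1 (iter a.2 A b.1), zk_add a.2 b.2).

Definition sdp_lam (a : VT * 'I_k) : VT * 'I_k :=
  (addV (addV (A' a.1) u0) (oppV (iter a.2 A u0)), a.2).

Definition sdp_circ (a b : VT * 'I_k) : VT * 'I_k :=
  sdp_add a (iter a.2 sdp_lam b).

End SDP.

(* Main.v *)
(* Part (a). [lambda ^ k = 1] makes [a o b = a + lambda ^ |a| (b)] a group law.
   Identifying [V + x] with [V], the solution is affine over the commutative ring
   generated by [A] and [A'], with coefficients [A'], [(AA')^-1] and [1 - A^-1];
   the latter is invertible by simplicity of [V].  The fibres of a morphism out of
   it form a congruence of [V] stable under [A] and [A'], hence a trivial one.

   Part (b). [B * B] is an ideal contained in [V], so it is [0] or [V]; with
   [B^(3) = 0] this makes [lambda_v] trivial for [v] in [V].  Hence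
   [X = {v + x - v}], [lambda_{v + ix} = lambda_x ^ i], and the subgroups of [V]
   stable under [A] and [A'] are exactly the ideals inside [V], so [V] is a simple
   module.  An endomorphism of [V] commuting with [A] and [A'] then fixes all or
   only [0]; this yields that [V] and [<x>] meet trivially and that the orders of
   [A] and [A'] divide [p ^ n - 1].  Finally, if [A ^ m = 1] and
   [lambda_x ^ m = 1], then [<mx>] is an ideal avoiding [V], so [mx = 0]; this
   bounds [k] from above. *)
Require Import Defs.
From HB Require Import structures.
From mathcomp Require Import all_boot all_fingroup all_solvable all_algebra ssrAC.
From mathcomp Require Import boolp.
Set Implicit Arguments.
Unset Strict Implicit.
Unset Printing Implicit Defensive.
Import GRing.Theory.

(** * Bundled group structures on unbundled carriers *)

Definition add_fingroup (T : finType) (add : T -> T -> T) (zero : T) (opp : T -> T)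
  (addG : is_group add zero opp) : Type := T.

Section AddFingroup.
Variables (T : finType) (add : T -> T -> T) (zero : T) (opp : T -> T).
Hypothesis addG : is_group add zero opp.

Let addA : associative add. Proof. by case: addG. Qed.
Let add0 : left_id zero add. Proof. by case: addG. Qed.
Let addr0 : right_id zero add. Proof. by case: addG. Qed.
Let addN : left_inverse zero opp add. Proof. by case: addG => _ _ _ H a; case: (H a). Qed.
Let addrN : right_inverse zero opp add. Proof. by case: addG => _ _ _ H a; case: (H a). Qed.

HB.instance Definition _ := Finite.copy (add_fingroup addG) T.
HB.instance Definition _ := isGroup.Build (add_fingroup addG) addA add0 addr0 addN addrN.
End AddFingroup.

(** As in [add_fingroup], the proofs are parameters of the alias, so that a structure built from
    them can be attached to it without touching [T] itself. *)
Definition add_zmod (T : finType) (add : T -> T -> T) (zero : T) (opp : T -> T)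
  (addG : is_group add zero opp) (addC : commutative add) : Type := T.

Section AddZmod.
Variables (T : finType) (add : T -> T -> T) (zero : T) (opp : T -> T).
Hypotheses (addG : is_group add zero opp) (addC : commutative add).

Let addA : associative add. Proof. by case: addG. Qed.
Let add0 : left_id zero add. Proof. by case: addG. Qed.
Let addN : left_inverse zero opp add. Proof. by case: addG => _ _ _ H a; case: (H a). Qed.

HB.instance Definition _ := Finite.copy (add_zmod addG addC) T.
HB.instance Definition _ := GRing.isZmodule.Build (add_zmod addG addC) addA addC add0 addN.
End AddZmod.

Lemma is_addsubgroupP (T : finType) (add : T -> T -> T) zero opp (H : {set T}) :
  reflect [/\ zero \in H, {in H &, forall a b, add a b \in H} &
              {in H, forall a, opp a \in H}]
          (is_addsubgroup add zero opp H).
Proof.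
apply: (iffP and3P) => -[H0 HD HN]; split=> //.
- by move=> a b aH bH; apply: (forall_inP (forall_inP HD a aH)).
- by move=> a aH; apply: (forall_inP HN).
- by apply/forall_inP=> a aH; apply/forall_inP=> b; apply: HD.
- by apply/forall_inP.
Qed.

Lemma in_imset_surj (T : finType) (X : {set T}) (f : T -> T) :
  {in X &, injective f} -> {in X, forall a, f a \in X} -> f @: X = X.
Proof.
move=> f_inj fX; apply/eqP; rewrite eqEcard (card_in_imset f_inj) leqnn andbT.
by apply/subsetP=> _ /imsetP[a aX ->]; apply: fX.
Qed.

(** * Affine solutions over a finite abelian group *)

Section AffineSolution.
Variables (V : finZmodType) (T : finType) (e : V -> T) (r : T * T -> T * T).
Variables (P D E : {additive V -> V}) (c d : V).
Hypothesis e_inj : injective e.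
Hypotheses (P_inj : injective P) (D_inj : injective D) (E_inj : injective E).
Hypothesis rE : forall v w, r (e v, e w) = (e (P w + c)%R, e (D v + E w + d)%R).

Local Notation X := [set e v | v : V].

Let eX v : e v \in X. Proof. exact: imset_f. Qed.

Lemma affine_closed : {in setX X X, forall a, r a \in setX X X}.
Proof.
by move=> [_ _] /setXP[/imsetP[v _ ->] /imsetP[w _ ->]]; rewrite rE in_setX !eX.
Qed.

Lemma affine_injective : {in setX X X &, injective r}.
Proof.
move=> [a b] [a' b'] /setXP[/imsetP[v _ ->] /imsetP[w _ ->]].
move=> /setXP[/imsetP[v' _ ->] /imsetP[w' _ ->]]; rewrite !rE.
by case=> /e_inj/addIr/P_inj-> /e_inj/addIr/addIr/D_inj->.
Qed.

Lemma affine_bijective : r @: setX X X = setX X X.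
Proof. exact: in_imset_surj affine_injective affine_closed. Qed.

Lemma affine_nondegenerate : nondegenerate_on X r.
Proof.
split=> [||_ /imsetP[v _ ->]|_ /imsetP[w _ ->]].
- exact: affine_injective.
- exact: affine_bijective.
- have inj : {in X &, injective (sol_lam r (e v))}.
    move=> _ _ /imsetP[w _ ->] /imsetP[w' _ ->]; rewrite /sol_lam !rE.
    by move=> /e_inj/addIr/P_inj->.
  by split=> //; apply: in_imset_surj => // _ /imsetP[w _ ->]; rewrite /sol_lam rE eX.
- have inj : {in X &, injective (sol_rho r (e w))}.
    move=> _ _ /imsetP[v _ ->] /imsetP[v' _ ->]; rewrite /sol_rho !rE.
    by move=> /e_inj/addIr/addIr/D_inj->.
  by split=> //; apply: in_imset_surj => // _ /imsetP[v _ ->]; rewrite /sol_rho rE eX.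
Qed.

(** The value of [rho_b] at the single point [e 0] already determines [b], because [E] is
    injective. *)
Lemma affine_irretractable : irretractable_on X r.
Proof.
move=> a b /imsetP[v _ ->] /imsetP[w _ ->] /(_ _ (eX 0%R))[_].
by rewrite /sol_rho !rE => /e_inj/addIr/addrI/E_inj->.
Qed.

Lemma affine_solution :
    ybe (fun vw : V * V => ((P vw.2 + c)%R, (D vw.1 + E vw.2 + d)%R)) ->
  solution_on X r.
Proof.
move=> braid; split=> [a b aX bX|a b b'].
  by apply: affine_closed; rewrite in_setX aX.
move=> /imsetP[u _ ->] /imsetP[v _ ->] /imsetP[w _ ->].
by have /= := braid (u, v, w) => -[Eb Ec]; do 4!rewrite /= ?rE; rewrite Eb Ec.
Qed.

Hypothesis V_gt1 : 1 < #|V|.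
Hypothesis V_simple : forall W : {set V}, is_addsubgroup +%R 0%R (@GRing.opp V) W ->
  P @: W \subset W -> D @: W \subset W -> W = [set 0%R] \/ W = setT.

(* The fibres of a morphism are a congruence of (V,+): feeding a pair into the
   second component shows that [D v + z] and [D w + z] are identified for every
   [z] as soon as [v] and [w] are, and [D] has finite order. *)
Lemma affine_simple : simple_on X r.
Proof.
split=> [|Y s f _ fX fr]; first by rewrite card_imset.
pose R v w := f (e v) = f (e w).
have RP v w : R v w -> R (P v + c)%R (P w + c)%R.
  move=> Rvw; have := fr _ _ (eX 0%R) (eX v); rewrite Rvw fr ?eX // !rE.
  by rewrite /R => -[->].
have RD v w z : R v w -> R (D v + z)%R (D w + z)%R.
  (* Surjectivity of [E] on the finite [V] lets a suitable second argument produce any prescribed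
     translation [z]. *)
  have [y Ey] : exists y, E y = (z - d)%R.
    by have [g _ gK] := injF_bij E_inj; exists (g (z - d)%R); rewrite gK.
  move=> Rvw; have := fr _ _ (eX v) (eX y); rewrite Rvw fr ?eX // !rE.
  by rewrite /R Ey -!addrA addNr !addr0 => -[->].
have RDi i v w z : R v w -> R (iter i.+1 D v + z)%R (iter i.+1 D w + z)%R.
  elim: i z => [|i IH] z Rvw; first exact: RD.
  by rewrite ![iter i.+2 _ _]iterS; apply: RD; have := IH 0%R Rvw; rewrite !addr0.
have Radd v w z : R v w -> R (v + z)%R (w + z)%R.
  (* The product of the two orbit lengths is a common period of [v] and [w] under [D], so the
     iterates disappear. The predecessor compensates for [RDi] counting from one. *)
  move=> /(RDi (fingraph.order D v * fingraph.order D w).-1 _ _ z).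
  rewrite prednK ?muln_gt0 ?fingraph.order_gt0 //.
  rewrite {1}mulnC !iterM !(iter_fix _ (fingraph.iter_order D_inj _)) //.
(* By translation invariance the congruence is determined by the class [W] of [0]. Equality in [Y]
   is decided classically, since [Y] is an arbitrary type. *)
pose W := [set v | `[< R v 0%R >]].
have WP v : reflect (R v 0%R) (v \in W) by rewrite inE; apply: asboolP.
have [|||W0|WT] := V_simple (W := W).
- apply/is_addsubgroupP; split=> [|v w /WP v0 /WP w0|v /WP v0]; apply/WP => //.
    by apply: etrans w0; have := Radd _ _ w v0; rewrite add0r.
  by have := Radd _ _ (- v)%R v0; rewrite subrr add0r => /esym.
- apply/subsetP=> _ /imsetP[v /WP v0 ->]; apply/WP.
  by have /(Radd _ _ (- c)%R) := RP _ _ v0; rewrite !addrK raddf0.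
- apply/subsetP=> _ /imsetP[v /WP v0 ->]; apply/WP.
  by have := RD _ _ 0%R v0; rewrite !addr0 raddf0.
- left=> _ _ /imsetP[v _ ->] /imsetP[w _ ->] /(Radd _ _ (- w)%R); rewrite subrr.
  by move/WP; rewrite W0 inE subr_eq0 => /eqP->.
- right=> y1 y2; have [_ /imsetP[v _ ->] <-] := fX y1.
  have [_ /imsetP[w _ ->] <-] := fX y2.
  have R0 u : R u 0%R by apply/WP; rewrite WT.
  exact: etrans (R0 v) (esym (R0 w)).
Qed.

End AffineSolution.

(** The first components of the braid relation agree identically. In the middle ones the constants
    match through [D c + d = 0] and [P d + c = E c]. In the last ones the coefficient of the third
    variable gives [E = E P D + E^2], and the remaining constants form [E (D c + d) = 0]. *)
Lemma affine_braid (V : zmodType) (P D E : {additive V -> V}) (c d : V) :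
    (forall v, P (D v) = D (P v)) -> (forall v, P (E v) = E (P v)) ->
    (forall v, D (E v) = E (D v)) ->
    (forall v, E v = (E (P (D v)) + E (E v))%R) ->
    (D c + d)%R = 0%R -> (P d + c)%R = E c ->
  ybe (fun vw : V * V => ((P vw.2 + c)%R, (D vw.1 + E vw.2 + d)%R)).
Proof.
move=> PD PE DE EE Dcd Pdc [[a b] e] /=; congr (_, _, _); rewrite !raddfD /=.
  rewrite [LHS](AC (2*2*1) (1*3*(2*5*4)))/= Dcd add0r.
  by rewrite [RHS](ACl (1*2*(3*4)))/= Pdc PD PE.
rewrite [RHS](AC ((1*2)*1*3*1) (1*5*4*(2*6)*8*(3*7)))/=.
rewrite -DE [D (E c)]DE -[(E (D c) + E d)%R](raddfD E) Dcd raddf0 addr0.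
by rewrite [D (E (P e))]DE -PD -EE.
Qed.

(** * The skew brace on the semidirect product *)

Section Construction.
Variables (V : finZmodType) (k : nat) (hk : 1 < k).
Variables (A P : {additive V -> V}) (u0 : V).
Hypothesis AP : forall v, A (P v) = P (A v).
Hypothesis Ak : forall v, iter k A v = v.

Local Notation B := (V * 'I_k)%type.
Local Notation addB := (sdp_add +%R A (k := k)).
Local Notation lamB := (sdp_lam +%R (@GRing.opp V) A P u0 (k := k)).
Local Notation circB := (sdp_circ +%R (@GRing.opp V) A P u0 (k := k)).

Hypothesis lamk : forall b, iter k lamB b = b.

Let o : 'I_k := Ordinal (ltnW hk).
Let x : B := (0%R, Ordinal hk).

Lemma iter_raddf (f : {additive V -> V}) i :
  {morph iter i f : v w / (v + w)%R}.
Proof. by elim: i => // i IH v w; rewrite !iterS IH raddfD. Qed.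

Lemma iter_raddf0 (f : {additive V -> V}) i : iter i f 0%R = 0%R.
Proof. by elim: i => // i IH; rewrite !iterS IH raddf0. Qed.

Lemma iter_raddfN (f : {additive V -> V}) i v : iter i f (- v)%R = (- iter i f v)%R.
Proof. by elim: i => // i IH; rewrite !iterS IH raddfN. Qed.

Lemma iter_mod (T : Type) (f : T -> T) m i v :
  (forall v, iter m f v = v) -> iter (i %% m) f v = iter i f v.
Proof.
move=> fm; rewrite {2}(divn_eq i m) addnC iterD; congr iter.
by elim: (i %/ m) => // q IH; rewrite mulSn iterD fm.
Qed.

Lemma zk_addA : associative (@zk_add k).
Proof. by move=> a b c; apply: val_inj; rewrite /= modnDmr modnDml addnA. Qed.

Lemma addBA : associative addB.
Proof.
move=> a b c; rewrite /sdp_add /= zk_addA; congr (_, _).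
by rewrite iter_mod // iterD iter_raddf addrA.
Qed.

Definition zeroB : B := (0%R, o).
(** Since [A^k = 1], the power [A^(k-i)] plays the role of [A^-i]. The remainder matters at [i = 0],
    where [k - i] is [k]. *)
Definition oppB (a : B) : B :=
  ((- iter (k - a.2) A a.1)%R, Ordinal (ltn_pmod (k - a.2) (ltnW hk))).

Lemma addB0 : right_id zeroB addB.
Proof.
case=> v i; rewrite /sdp_add /= iter_raddf0 addr0; congr (_, _).
by apply: val_inj; rewrite /= addn0 modn_small.
Qed.

Lemma add0B : left_id zeroB addB.
Proof.
case=> v i; rewrite /sdp_add /= add0r; congr (_, _).
by apply: val_inj; rewrite /= add0n modn_small.
Qed.

Lemma addBN a : addB a (oppB a) = zeroB.
Proof.
case: a => v i; rewrite /sdp_add /= iter_raddfN -iterD subnKC ?(ltnW (ltn_ord i)) //.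
rewrite Ak subrr; congr (_, _); apply: val_inj => /=.
by rewrite modnDmr subnKC ?modnn // ltnW.
Qed.

Lemma right_inv_group (T : Type) (op : T -> T -> T) e inv :
    associative op -> left_id e op -> right_id e op ->
  (forall a, op a (inv a) = e) -> is_group op e inv.
Proof.
move=> opA op1 op1r opV; split=> // a; split=> //.
by rewrite -{2}[a]op1r -[X in op a X](opV (inv a)) (opA a) opV op1 opV.
Qed.

Lemma addB_group : is_group addB zeroB oppB.
Proof. exact: right_inv_group addBA add0B addB0 addBN. Qed.

(** The correction term is a cocycle: [u0 - A^(i+j) u0 = (u0 - A^i u0) + A^i (u0 - A^j u0)]. The
    linear parts match because [A] and [P] commute. *)
Lemma lamB_D : {morph lamB : a b / addB a b}.
Proof.
move=> a b; rewrite /sdp_lam /sdp_add /=; congr (_, _).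
rewrite iter_mod // iterD raddfD iter_raddf iter_raddfN iter_raddf.
have -> : iter a.2 A (P b.1) = P (iter a.2 A b.1).
  by elim: (val a.2) => //= i ->; rewrite AP.
by rewrite [RHS](AC (3*3) (1*4*2*6*(3*5)))/= addNr addr0.
Qed.

Lemma iter_lamB_D i : {morph iter i lamB : a b / addB a b}.
Proof. by elim: i => // i IH a b; rewrite !iterS IH lamB_D. Qed.

Lemma iter_lamB2 i b : (iter i lamB b).2 = b.2.
Proof. by elim: i b => // i IH b; rewrite iterS /= IH. Qed.

(** [lamB] is additive and keeps the second coordinate, so [|a o b|] is [|a| + |b|] modulo [k];
    reducing this exponent is harmless because [lamB^k = 1]. *)
Lemma circBA : associative circB.
Proof.
move=> a b c; rewrite /sdp_circ iter_lamB_D addBA; congr addB.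
by rewrite -iterD -[LHS](iter_mod _ _ lamk) /= iter_lamB2.
Qed.

Lemma lamB0 : lamB zeroB = zeroB.
Proof. by rewrite /sdp_lam /= raddf0 add0r subrr. Qed.

Lemma iter_lamB0 i : iter i lamB zeroB = zeroB.
Proof. by elim: i => // i IH; rewrite iterS IH lamB0. Qed.

Definition invB (a : B) : B := iter (k - a.2) lamB (oppB a).

Lemma circB_group : is_group circB zeroB invB.
Proof.
apply: right_inv_group circBA _ _ _ => a; rewrite /sdp_circ ?add0B //.
  by rewrite iter_lamB0 addB0.
by rewrite /invB -iterD subnKC ?lamk ?addBN // ltnW.
Qed.

Lemma braceB : is_skew_brace addB zeroB oppB circB zeroB invB.
Proof.
split; [exact: addB_group | exact: circB_group | move=> a b c].
rewrite /sdp_circ iter_lamB_D addBA -!addBA; congr addB; congr addB.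
by rewrite addBA; case: addB_group => _ _ _ /(_ a) [-> _]; rewrite add0B.
Qed.

Lemma blamB a b : blam addB oppB circB a b = iter a.2 lamB b.
Proof.
rewrite /blam /sdp_circ addBA; case: addB_group => _ _ _ /(_ a) [-> _].
exact: add0B.
Qed.

End Construction.

Lemma additive_of (V : zmodType) (f : V -> V) :
  {morph f : v w / (v + w)%R} -> exists g : {additive V -> V}, g = f :> (V -> V).
Proof.
move=> fD; have fB : zmod_morphism f.
  by move=> v w; apply: (addIr (f w)); rewrite -fD !addrNK.
pose g : {additive V -> V} := HB.pack f (GRing.isZmodMorphism.Build V V f fB).
by exists g.
Qed.

Lemma finv_additive (V : finZmodType) (f : {additive V -> V}) :
  injective f -> exists g : {additive V -> V}, g = finv f :> (V -> V).
Proof.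
move=> f_inj; apply: additive_of => v w.
by apply: (f_inj); rewrite raddfD /= !(f_finv f_inj).
Qed.

(* In a simple module, the fixed points of an endomorphism commuting with the
   action form a submodule. *)
Lemma simple_module_fix (G : finType) add zero opp (V : {set G}) A A' f :
    is_group add zero opp -> is_addsubgroup add zero opp V ->
    simple_module_on add zero opp V A A' ->
    {in V, forall v, A v \in V} -> {in V, forall v, A' v \in V} ->
    {in V, forall v, f v \in V} ->
    {in V &, {morph f : v w / add v w}} ->
    {in V, forall v, f (A v) = A (f v)} -> {in V, forall v, f (A' v) = A' (f v)} ->
  {in V, forall v, f v = v} \/ {in V, forall v, f v = v -> v = zero}.
Proof.
move=> [addA add0 addr0 addN] /is_addsubgroupP[V0 VD VN] [_ simpleV].
move=> AV A'V fV fD fA fA'.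
pose W := [set v in V | f v == v].
have addI a : injective (add a).
  by move=> b c eq_ab; rewrite -[b]add0 -(proj1 (addN a)) -addA eq_ab addA (proj1 (addN a)).
have f0 : f zero = zero.
  by apply: (addI (f zero)); rewrite -fD // add0 addr0.
case: (simpleV W).
- by apply/subsetP=> v; rewrite inE => /andP[].
- apply/is_addsubgroupP; split=> [|v w|v]; rewrite !inE ?V0 ?f0 ?eqxx //.
    by move=> /andP[vV /eqP fv] /andP[wV /eqP fw]; rewrite VD // fD // fv fw /=.
  move=> /andP[vV /eqP fv]; rewrite VN //=; apply/eqP/(addI v).
  by rewrite -{1}fv -fD ?VN // (proj2 (addN v)).
- apply/subsetP=> _ /imsetP[v /[!inE] /andP[vV /eqP fv] ->].
  by rewrite AV // fA // fv /=.
- apply/subsetP=> _ /imsetP[v /[!inE] /andP[vV /eqP fv] ->].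
  by rewrite A'V // fA' // fv /=.
- move=> W0; right=> v vV fv; apply/set1P.
  by rewrite -W0 inE vV fv /=.
- by move=> WV; left=> v; rewrite -{1}WV inE => /andP[_ /eqP].
Qed.

(** * The solution carried by the coset of [x] *)

Section ConstructedSolution.
Variables (V : finZmodType) (k : nat) (hk : 1 < k).
Variables (A P Ai D : {additive V -> V}) (u0 : V).
Hypotheses (AP : forall v, A (P v) = P (A v)) (Ak : forall v, iter k A v = v).
Hypotheses (AiK : cancel Ai A) (DK : forall v, A (P (D v)) = v).
Hypotheses (A_inj : injective A) (P_inj : injective P).
Hypothesis A_fix : forall v, A v = v -> v = 0%R.
Hypothesis lamk : forall b, iter k (sdp_lam +%R (@GRing.opp V) A P u0 (k := k)) b = b.

Local Notation B := (V * 'I_k)%type.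
Local Notation addB := (sdp_add +%R A (k := k)).
Local Notation lamB := (sdp_lam +%R (@GRing.opp V) A P u0 (k := k)).
Local Notation circB := (sdp_circ +%R (@GRing.opp V) A P u0 (k := k)).
Local Notation oppB := (oppB hk A).
Local Notation invB := (invB hk A P u0).
Let e (v : V) : B := (v, Ordinal hk).
Let v1 := (u0 - A u0)%R.
Local Notation r := (brB addB oppB circB invB).

Lemma rB_formula v w :
  r (e v, e w) = (e (P w + v1)%R, e (- Ai w + D (v - v1) + w)%R).
Proof.
rewrite /brB /= blamB //= /sdp_lam /= -addrA -/(e _); congr (_, _).
have [circA circ0 circr0 circN] := circB_group hk AP Ak lamk.
set z := e (- Ai w + _ + _)%R; set l := e (P w + v1)%R.
(* Instead of computing the inverse of [l], it suffices to check [e v o e w = l o z] and cancel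
   [l]. *)
suff -> : circB (circB (invB l) (e v)) (e w) = circB (invB l) (circB l z).
  by rewrite circA (proj1 (circN l)) circ0.
rewrite -circA; congr circB; rewrite /sdp_circ /sdp_add /sdp_lam /=; congr (_, _).
rewrite -!(addrA _ u0) -/v1 !(raddfD A) !(raddfD P) !(raddfD A) !raddfN !DK !AP AiK.
rewrite addrA [RHS]addrA; congr (_ + _)%R.
by rewrite [RHS](AC (2*(1*2*1)) (4*((1*3)*(2*5))*6))/= !subrr !addr0.
Qed.

Lemma D_comm (f : {additive V -> V}) : (forall v, f (A v) = A (f v)) ->
  (forall v, f (P v) = P (f v)) -> forall v, f (D v) = D (f v).
Proof. by move=> fA fP v; apply/P_inj/A_inj; rewrite DK -fP -fA DK. Qed.

Lemma PD v : P (D v) = Ai v.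
Proof. by apply: A_inj; rewrite DK AiK. Qed.

Lemma Ai_comm (f : {additive V -> V}) : (forall v, f (A v) = A (f v)) ->
  forall v, f (Ai v) = Ai (f v).
Proof. by move=> fA v; apply: A_inj; rewrite -fA !AiK. Qed.

Hypothesis simpleV : simple_module_on +%R 0%R (@GRing.opp V) setT A P.

Lemma constructed_solution (X := [set e v | v : V]) :
  [/\ r @: setX X X = setX X X, solution_on X r, nondegenerate_on X r,
      irretractable_on X r & simple_on X r].
Proof.
pose E : {additive V -> V} := (idfun \- Ai)%R.
have EE v : E v = (v - Ai v)%R by [].
have Ai_inj : injective Ai := can_inj AiK.
have D_inj : injective D by move=> v w Dvw; rewrite -[v]DK Dvw DK.
have E_inj : injective E.
  apply: raddf_inj => v; rewrite EE => /eqP; rewrite subr_eq0 => /eqP Aiv.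
  by apply: A_fix; rewrite {1}Aiv AiK.
(* The affine form has constants [c = v1] and [d = - D v1]. Then [D c + d = 0], and
   [P d + c = v1 - Ai v1 = E c] because [P D = Ai]. *)
have rE v w : r (e v, e w) = (e (P w + v1)%R, e (D v + E w - D v1)%R).
  by rewrite rB_formula EE raddfB; congr (_, e _); rewrite [LHS](AC (1*2*1) (2*(4*1)*3)).
have PAi v : P (Ai v) = Ai (P v) by apply: Ai_comm => {}v; rewrite AP.
have DP v : P (D v) = D (P v) by apply: D_comm => {}v; rewrite ?AP.
have DA v : D (A v) = A (D v) by symmetry; apply: D_comm => {}v; rewrite ?AP.
have DAi v : D (Ai v) = Ai (D v) by apply: Ai_comm.
have e_inj : injective e by move=> v w [].
split.
- exact: affine_bijective e_inj P_inj D_inj rE.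
- apply: affine_solution rE _; apply: affine_braid => [v|v|v|v||]; rewrite ?EE.
  + exact: DP.
  + by rewrite raddfB PAi.
  + by rewrite raddfB DAi.
  + by rewrite PD raddfB [RHS]addrC addrNK.
  + by rewrite subrr.
  + by rewrite raddfN PD addrC.
- exact: affine_nondegenerate e_inj P_inj D_inj rE.
- exact: affine_irretractable e_inj E_inj rE.
- have [V_neq0 V_simple] := simpleV.
  apply: (affine_simple e_inj D_inj E_inj rE) => [|W Wgrp PW DW].
    rewrite ltnNge; apply: contra V_neq0 => V1; rewrite eq_sym eqEcard sub1set inE.
    by rewrite cards1 cardsT.
  apply: V_simple => //; rewrite ?subsetT //.
  (* Stability under [A] has to come from stability under [P] and [D]. On the finite [W] both
     injections are onto, so each [v] in [W] is [P (D w)] with [w] in [W], and then [A v = w]. *)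
  have fullP f : injective f -> f @: W \subset W -> f @: W = W.
    move=> f_inj fW; apply: in_imset_surj => [v w _ _ /f_inj // | v vW].
    by apply: (subsetP fW); apply: imset_f.
  apply/subsetP=> _ /imsetP[v vW ->].
  move: vW; rewrite -{1}(fullP P P_inj PW) => /imsetP[v' + ->].
  rewrite -{1}(fullP D D_inj DW) => /imsetP[w wW ->].
  by rewrite DK.
Qed.

End ConstructedSolution.

(** * The construction *)

Lemma iter_dvd (T : Type) (f : T -> T) m k x :
  m %| k -> iter m f x = x -> iter k f x = x.
Proof.
move=> /dvdnP[q ->] fx; rewrite iterM.
by elim: q => //= q ->.
Qed.

(* [lambda^k] maps [0 + jx] to [w + jx] for some [w]; it commutes with [lambda],
   so [w] is fixed by [A'] and vanishes unless [A' = 1]. *)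
Lemma iter_lamB_id (V : finZmodType) (k p : nat) (hk : 1 < k)
    (A P : {additive V -> V}) (u0 : V) :
    (forall v, A (P v) = P (A v)) -> (forall v, iter k A v = v) ->
    (forall v, iter k P v = v) ->
    (forall v : V, (v *+ p = 0)%R) ->
    (forall v, P v = v) \/ (forall v, P v = v -> v = 0%R) ->
    ((forall v, P v = v) -> (u0 - A u0 != 0)%R -> p %| k) ->
  forall b, iter k (sdp_lam +%R (@GRing.opp V) A P u0 (k := k)) b = b.
Proof.
move=> AP Ak Pk Vp Pcases kp; set lam := @sdp_lam _ _ _ _ _ _ k.
case: Pcases => [P1 | Pfix] [v j].
  have lamE i : iter i lam (v, j) = ((v + (u0 - iter j A u0) *+ i)%R, j).
    elim: i => [|i IH]; first by rewrite addr0.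
    by rewrite iterS IH /lam /sdp_lam /= P1 mulrSr -!addrA.
  have Vdvd m w : p %| m -> (w *+ m = 0 :> V)%R.
    by case/dvdnP=> q ->; rewrite mulnC mulrnA Vp mul0rn.
  rewrite lamE; suff -> : ((u0 - iter j A u0) *+ k = 0)%R by rewrite addr0.
  (* Either [p] divides [k] and the multiple vanishes, or [A] fixes [u0] and every [u0 - A^j u0] is
     zero. *)
  have [/eqP | /(kp P1)] := eqVneq (u0 - A u0)%R 0%R; last exact: Vdvd.
  by rewrite subr_eq0 => /eqP Au0; rewrite iter_fix // subrr mul0rn.
pose o : 'I_k := Ordinal (ltnW hk).
have lam1 w i : lam (w, i) = (P w + u0 - iter i A u0, i)%R by [].
have lam_o i w : iter i lam (w, o) = (iter i P w, o).
  by elim: i => // i IH; rewrite iterS IH /lam /sdp_lam /= addrK.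
have split_o w i : (w, i) = sdp_add +%R A (w, o) (0%R, i).
  by rewrite /sdp_add /= addr0; congr (_, _); apply: val_inj; rewrite /= add0n modn_small.
have addo w u i : sdp_add +%R A (w, o) (u, i) = ((w + u)%R, i).
  by rewrite /sdp_add /=; congr (_, _); apply: val_inj; rewrite /= add0n modn_small.
have lamD i : {morph iter i lam : a b / sdp_add +%R A (k := k) a b}.
  by apply: iter_lamB_D => // w.
rewrite split_o lamD lam_o Pk; case E: (iter k lam (0%R, j)) => [w j'].
have Ej : j' = j by rewrite -[j]/((0%R, j) : V * 'I_k).2 -(iter_lamB2 A P u0 k) -/lam E.
rewrite {}Ej in E *; suff -> : w = 0%R by [].
apply: Pfix; have := iterSr k lam (0%R, j); rewrite iterS E.
rewrite !lam1 raddf0 add0r (split_o (u0 - _)%R) lamD lam_o Pk E addo.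
by rewrite -addrA addrC => -[/addrI].
Qed.

Lemma construction (V : finZmodType) (p n k : nat) (A P : {additive V -> V})
    (u0 : V) (hk : 1 < k)
    (o : 'I_k := Ordinal (ltnW hk)) (x : V * 'I_k := (0%R, Ordinal hk))
    (addB := sdp_add +%R A (k := k))
    (circB := sdp_circ +%R (@GRing.opp V) A P u0 (k := k)) (v1 := (u0 - A u0)%R) :
    hypA +%R 0%R (@GRing.opp V) [set: V] p n k A P u0 ->
  exists (zeroB : V * 'I_k) (oppB : V * 'I_k -> V * 'I_k)
         (oneB : V * 'I_k) (invB : V * 'I_k -> V * 'I_k),
    is_skew_brace addB zeroB oppB circB oneB invB /\
    let r := brB addB oppB circB invB in
    let X := [set addB (addB (v, o) x) (oppB (v, o)) | v : V] in
    [/\ X = [set addB (v, o) x | v : V],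
        r @: setX X X = setX X X,
        solution_on X r /\ nondegenerate_on X r,
        irretractable_on X r /\ simple_on X r &
        forall v w : V,
          r (addB (v, o) x, addB (w, o) x) =
          (addB (P w + v1, o)%R x,
           addB (- finv A w + finv (A \o P) (v - v1) + w, o)%R x)].
Proof.
move=> [[[p_pr n_gt0 Vgrp _ [_ Vp]] _] [[A_inj _ _] [[P_inj _ _] AP]]
  [_ A_neq1] [oA [oP [[_ oAP _] [_ oPP _] dA dP
  [k1 k2 k3]]]] simpleV].
have Vp0 (v : V) : (v *+ p = 0)%R by rewrite -iter_addr_0 Vp.
have {}A_inj : injective A by move=> v w; apply: A_inj.
have {}P_inj : injective P by move=> v w; apply: P_inj.
have {}AP v : A (P v) = P (A v) by apply: AP.
have Ak v : iter k A v = v.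
  exact: iter_dvd (dvdn_trans dA (dvdn_gcdl _ _)) (oAP v (in_setT v)).
have Pk v : iter k P v = v.
  exact: iter_dvd (dvdn_trans dP (dvdn_gcdl _ _)) (oPP v (in_setT v)).
have addG : is_group +%R 0%R (@GRing.opp V).
  split; [exact: addrA | exact: add0r | exact: addr0 | move=> v].
  by rewrite subrr addNr.
have fix_dich (f : {additive V -> V}) : (forall v, f (A v) = A (f v)) ->
    (forall v, f (P v) = P (f v)) ->
    (forall v, f v = v) \/ (forall v, f v = v -> v = 0%R).
  move=> fA fP.
  have [||||||fV|fV] := simple_module_fix (f := f) addG Vgrp simpleV;
    try by move=> *; rewrite ?inE ?raddfD ?fA ?fP.
  - by left=> v; apply: fV.
  - by right=> v; apply: fV.
have A_fix v : A v = v -> v = 0%R.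
  have [A1|] := fix_dich A (fun=> erefl) AP; last exact.
  by case: A_neq1 => w _; apply: A1.
have lamk : forall b, iter k (sdp_lam +%R (@GRing.opp V) A P u0 (k := k)) b = b.
  apply: (iter_lamB_id hk AP Ak Pk Vp0) => [|P1 v1_neq0].
    by apply: fix_dich => // v; rewrite AP.
  by rewrite k2 ?dvdn_mulr //; apply/eqP.
have AP_inj : injective (A \o P) := inj_comp A_inj P_inj.
have [Ai AiE] := finv_additive A_inj.
have [D DE] := finv_additive (f := (A \o P)%R) AP_inj.
have AiK : cancel Ai A by move=> v; rewrite AiE f_finv.
have DK v : A (P (D v)) = v by rewrite DE; apply: (f_finv AP_inj).
pose e (v : V) : V * 'I_k := (v, Ordinal hk).
have addox v : addB (v, o) x = e v.
  by rewrite /addB /sdp_add /= addr0; congr (_, _); apply: val_inj; rewrite /= modn_small.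
exists (zeroB V hk), (oppB hk A), (zeroB V hk), (invB hk A P u0); split.
  exact: braceB.
move=> r; have XE : [set addB (addB (v, o) x) (oppB hk A (v, o)) | v : V] = [set e v | v : V].
  have addoN v : addB (addB (v, o) x) (oppB hk A (v, o)) = e (v - A v)%R.
    rewrite addox /addB /sdp_add /= subn0 Ak raddfN; congr (_, _).
    by apply: val_inj; rewrite /= modnn addn0 modn_small.
  (* Since [v + x - v = (v - A v) + x], the conjugates of [x] fill the whole coset once [1 - A] is
     onto, and on the finite [V] injectivity is enough. *)
  have E_inj : injective (fun v => v - A v)%R.
    apply: (@raddf_inj _ _ (idfun \- A)%R) => v /= /eqP.
    by rewrite subr_eq0 eq_sym => /eqP/A_fix.
  apply/eqP; rewrite eqEsubset; apply/andP; split; apply/subsetP=> _ /imsetP[v _ ->].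
    by rewrite addoN imset_f.
  have [g _ gK] := injF_bij E_inj.
  by apply/imsetP; exists (g v) => //; rewrite addoN gK.
rewrite XE.
have [rX sol nondeg irr simp] :=
  constructed_solution hk AP Ak AiK DK A_inj P_inj A_fix lamk simpleV.
split=> //; first by apply: eq_imset => v; rewrite addox.
move=> v w; rewrite !addox -AiE -DE; exact: rB_formula.
Qed.

(** * Skew braces over a finite group *)

Lemma order_dvd (T : finType) (f : T -> T) j v :
  injective f -> iter j f v = v -> fingraph.order f v %| j.
Proof.
move=> f_inj fjv; set o := fingraph.order f v.
have fr : iter (j %% o) f v = v.
  have := fjv; rewrite {1}(divn_eq j o) addnC iterD (@iter_dvd _ f o _ v) ?dvdn_mull //.
  exact: fingraph.iter_order.
have r_lt : j %% o < o by rewrite ltn_mod fingraph.order_gt0.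
(* The orbit of [v] lists its elements without repetition, so [v] can only recur at index [0], which
   forces [j %% o = 0]. *)
have := nth_uniq v _ _ (fingraph.orbit_uniq f v).
move=> /(_ (j %% o) 0); rewrite fingraph.size_orbit fingraph.order_gt0 r_lt => /(_ isT isT).
rewrite !nth_traject ?fingraph.order_gt0 //= fr eqxx => /esym/eqP.
by move/eqP.
Qed.

Lemma order_on_min (T : finType) (V : {set T}) (f : T -> T) o k :
  order_on V f o -> {in V, forall v, iter k f v = v} -> o %| k.
Proof.
move=> [o_gt0 fo o_min] fk; have fr v : v \in V -> iter (k %% o) f v = v.
  move=> vV; have := fk v vV; rewrite {1}(divn_eq k o) addnC iterD.
  by rewrite (iter_dvd (dvdn_mull _ (dvdnn o)) (fo v vV)).
rewrite /dvdn; case: posnP => // r_gt0.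
have [|v vV] := o_min (k %% o); first by rewrite r_gt0 ltn_mod.
by rewrite fr ?eqxx.
Qed.

(* If every power of [f] fixes all or nothing of [V \ {0}], all [f]-orbits on
   [V \ {0}] have length [o(f)]. *)
Lemma order_on_dvd (T : finType) (V : {set T}) (zero v0 : T) (f : T -> T) :
    injective f -> {in V, forall v, f v \in V} -> f zero = zero -> zero \in V ->
    v0 \in V -> v0 != zero ->
    (forall j, {in V, forall v, iter j f v = v} \/
               {in V, forall v, iter j f v = v -> v = zero}) ->
  exists2 o, order_on V f o & o %| #|V| - 1.
Proof.
move=> f_inj fV f0 zV v0V v0n0 dich; exists (fingraph.order f v0).
  have fo : {in V, forall v, iter (fingraph.order f v0) f v = v}.
    case: (dich (fingraph.order f v0)) => // /(_ v0 v0V (fingraph.iter_order f_inj _)).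
    by move/eqP; rewrite (negPf v0n0).
  split=> [||j /andP[j_gt0 j_lt]]; rewrite ?fingraph.order_gt0 //.
  exists v0 => //; apply/eqP=> /(order_dvd f_inj) /(dvdn_leq j_gt0).
  by rewrite leqNgt j_lt.
have iter_o v : v \in V -> v != zero -> forall w, w \in V -> iter (fingraph.order f v) f w = w.
  move=> vV vn0; case: (dich (fingraph.order f v)) => // /(_ v vV (fingraph.iter_order f_inj _)).
  by move/eqP; rewrite (negPf vn0).
have -> : #|V| - 1 = #|V :\ zero| by rewrite (cardsD1 zero V) zV addnC addnK.
rewrite -(@fingraph.fcard_order_set _ f f_inj (fingraph.order f v0)) ?dvdn_mull //.
  apply/subsetP=> v; rewrite !inE => /andP[vn0 vV].
  (* A power of [f] fixing one non-zero element fixes all of [V], so any two orbit lengths divide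
     each other. *)
  by rewrite eqn_dvd !order_dvd ?iter_o.
apply: (fingraph.intro_closed (fingraph.fconnect_sym f_inj)) => v _ /eqP<-.
by rewrite !inE => /andP[vn0 /fV->]; rewrite andbT -f0 (inj_eq f_inj).
Qed.

(** This is [blam] with the additive group of the brace written multiplicatively, the convention
    kept until the final theorem. *)
Definition lambda (gT : finGroupType) (circ : gT -> gT -> gT) (a b : gT) : gT :=
  (a^-1 * circ a b)%g.

(** * Lambda maps, ideals and the ideal [B * B] *)

Section Brace.
Local Open Scope group_scope.
Local Notation opp := (fun a => a^-1).
Variables (gT : finGroupType) (circ : gT -> gT -> gT) (one : gT) (inv : gT -> gT).
Hypothesis brace : is_skew_brace *%g 1 opp circ one inv.
Local Notation lam := (lambda circ).
Local Notation ideal := (is_ideal *%g 1 opp circ inv).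

Lemma circE a b : circ a b = a * lam a b.
Proof. by rewrite /lambda mulKVg. Qed.

Lemma lamM a : {morph lam a : b c / b * c}.
Proof.
by move=> b c; case: brace => _ _ circD; rewrite /lambda circD !mulgA.
Qed.

Lemma lam1 a : lam a 1 = 1.
Proof. by apply: (mulgI (lam a 1)); rewrite -lamM !mulg1. Qed.

Lemma lamV a b : lam a b^-1 = (lam a b)^-1.
Proof. by apply: (mulgI (lam a b)); rewrite -lamM !mulgV lam1. Qed.

Lemma lamX a b i : lam a (b ^+ i) = lam a b ^+ i.
Proof. by elim: i => [|i IH]; rewrite ?lam1 // !expgS lamM IH. Qed.

Lemma brace_one : one = 1.
Proof. by case: brace => _ [_ circ1 _ _] _; rewrite -(circ1 1) circE lam1 mulg1. Qed.

Lemma lam_circ a b c : lam (circ a b) c = lam a (lam b c).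
Proof.
case: brace => _ [circA _ _ _] _; apply: (mulgI (circ a b)).
by rewrite -circE -circA !circE lamM mulgA.
Qed.

Lemma lam_one b : lam 1 b = b.
Proof.
case: brace => _ [_ circ1 _ _] _.
by rewrite /lambda -brace_one circ1 brace_one invg1 mul1g.
Qed.

Lemma lam_inj a : injective (lam a).
Proof.
case: brace => _ [_ _ _ circV] _; apply: (can_inj (g := lam (inv a))) => b.
by rewrite -lam_circ (proj1 (circV a)) brace_one lam_one.
Qed.

Lemma idealP (I : {set gT}) :
  reflect [/\ group_set I, {in I, forall a b, b * a * b^-1 \in I},
              {in I, forall a b, lam b a \in I} &
              {in I, forall a b, circ (circ b a) (inv b) \in I}] (ideal I).
Proof.
have forP (F : gT -> gT -> gT) :
    reflect {in I, forall a b, F a b \in I} [forall a in I, forall b, F a b \in I].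
  apply: (iffP forall_inP) => FI a aI; first by move=> b; apply: (forallP (FI a aI)).
  by apply/forallP; apply: FI.
apply: (iffP and4P) => [[/is_addsubgroupP[I1 IM _] /forP ? /forP ? /forP ?] | [Igrp ? ? ?]].
  by split=> //; apply/group_setP.
split; [|exact/forP..]; pose G := Group Igrp.
apply/is_addsubgroupP; split; first exact: (group1 G).
  by move=> a b; apply: (@groupM _ G).
by move=> a aI; rewrite (@groupV _ G).
Qed.

(* Normality for [circ]: if [a] and hence [c = b + lambda_b a - b] act trivially,
   then [b o a = c + b = c o b]. *)
Lemma ideal_of_lam_trivial (I : {set gT}) :
    group_set I -> {in I, forall a b, b * a * b^-1 \in I} ->
    {in I, forall a b, lam b a \in I} -> {in I, forall a b, lam a b = b} ->
  ideal I.
Proof.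
move=> Igrp Inorm Ilam Itriv; apply/idealP; split=> // a aI b.
case: brace => _ [circA _ circ1 circV] _.
have -> : circ b a = circ (b * lam b a * b^-1) b.
  by rewrite [RHS]circE (Itriv (b * lam b a * b^-1)) ?Inorm ?Ilam // mulgKV circE.
by rewrite -circA (proj2 (circV b)) circ1 Inorm ?Ilam.
Qed.

Lemma ideal_gen_ideal (S : {set gT}) : ideal (ideal_gen *%g 1 opp circ inv S).
Proof.
have genP a : reflect (forall I, ideal I -> S \subset I -> a \in I)
                      (a \in ideal_gen *%g 1 opp circ inv S).
  rewrite inE; apply: (iffP forallP) => H I.
    by move=> I1 I2; apply: (implyP (H I)); apply/andP.
  by apply/implyP=> /andP[]; apply: H.
apply/idealP; split.
- apply/group_setP; split=> [|a b /genP aI /genP bI]; apply/genP=> I Iid SI.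
    by case/idealP: Iid => /group_setP[].
  have {}aI := aI I Iid SI; have {}bI := bI I Iid SI.
  by case/idealP: Iid => /group_setP[_ IM] _ _ _; apply: IM.
- move=> a /genP aI b; apply/genP=> I Iid SI; have {}aI := aI I Iid SI.
  by case/idealP: Iid => _ IN _ _; apply: IN.
- move=> a /genP aI b; apply/genP=> I Iid SI; have {}aI := aI I Iid SI.
  by case/idealP: Iid => _ _ IN _; apply: IN.
- move=> a /genP aI b; apply/genP=> I Iid SI; have {}aI := aI I Iid SI.
  by case/idealP: Iid => _ _ _ IN; apply: IN.
Qed.

Lemma sub_ideal_gen (S : {set gT}) : S \subset ideal_gen *%g 1 opp circ inv S.
Proof.
apply/subsetP=> a aS; rewrite inE; apply/forallP=> I; apply/implyP=> /andP[_ SI].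
exact: (subsetP SI).
Qed.

Lemma add_genE (S : {set gT}) : add_gen *%g 1 opp S = <<S>>.
Proof.
apply/setP=> a; rewrite inE; apply/forallP/idP=> [/(_ <<S>>) /implyP|aS H].
  apply; rewrite subset_gen andbT; apply/is_addsubgroupP.
  by split=> [|b c|b]; [exact: group1 | exact: groupM | rewrite groupV].
apply/implyP=> /andP[/is_addsubgroupP[H1 HM _] SH].
have Hgrp : group_set H by apply/group_setP.
by move: a aS; apply/subsetP; rewrite (@gen_subG _ _ (Group Hgrp)).
Qed.

Local Notation B2 := (B2 *%g 1 opp circ).

(* [B * B] is normal since [b + a*c - b = -(a*b) + a*(b+c)]. *)
Lemma B2_ideal : B3 *%g 1 opp circ = [set 1] ->
  ideal B2 /\ {in B2, forall a b, lam a b = b}.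
Proof.
move=> B3_1; have B2triv : {in B2, forall a b, lam a b = b}.
  move=> a aB2 b; have : bstar *%g opp circ a b \in B3 *%g 1 opp circ.
    rewrite /B3 add_genE; apply: mem_gen; apply/imset2P.
    by exists a b; rewrite ?in_setT.
  by rewrite B3_1 => /set1P /eqP; rewrite /bstar -/(lambda circ a b) -eq_mulgV1 => /eqP.
split=> //; pose S := [set bstar *%g opp circ a b | a in [set: gT], b in [set: gT]].
have B2E : B2 = <<S>> by rewrite /Defs.B2 add_genE.
have SB a b : lam a b * b^-1 \in <<S>>.
  by apply: mem_gen; apply/imset2P; exists a b; rewrite ?inE.
(* An endomorphism preserves the generated subgroup as soon as it sends the generators into it; this
   serves for both conjugation and [lam b]. *)
have genS (F : gT -> gT) : {morph F : a b / a * b} ->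
    (forall a b, F (lam a b * b^-1) \in <<S>>) -> {in <<S>>, forall a, F a \in <<S>>}.
  move=> FM FS a aS; pose f := Morphism (in2W FM : {in setT &, {morph F : a b / a * b}}).
  have : f @* <<S>> \subset <<S>>.
    rewrite morphim_gen ?subsetT // gen_subG; apply/subsetP=> _ /morphimP[b _ + ->].
    by case/imset2P=> c d _ _ ->; apply: FS.
  by move/subsetP; apply; apply: mem_morphim; rewrite ?inE.
apply: ideal_of_lam_trivial => //; rewrite B2E.
- exact: groupP.
- move=> a aS b; apply: (genS (fun a => b * a * b^-1)) aS => c d /=.
    by rewrite !mulgA mulgKV.
  have -> : b * (lam c d * d^-1) * b^-1 = (lam c b * b^-1)^-1 * (lam c (b * d) * (b * d)^-1).
    rewrite lamM; move: (lam c b) (lam c d) => y w.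
    by rewrite !invMg !invgK !mulgA mulgKV.
  by rewrite groupM ?groupV.
- move=> a aS b; apply: (genS (lam b)) aS => [|c d]; first exact: lamM.
  rewrite lamM lamV -lam_circ.
  case: brace => _ [circA _ circ1 circV] _.
  (* With [b'] the [circ]-inverse of [b], the map [lambda_b] sends the star product of [c] and [d]
     to that of [b o c o b'] and [lambda_b d], which is again a generator. *)
  have -> : circ b c = circ (circ (circ b c) (inv b)) b.
    by rewrite -circA (proj1 (circV b)) circ1.
  by rewrite lam_circ.
Qed.

End Brace.

(** * The converse *)

Local Opaque lambda.

Section Converse.
Local Open Scope group_scope.
Local Notation opp := (fun a => a^-1).
Variables (gT : finGroupType) (circ : gT -> gT -> gT) (one : gT) (inv : gT -> gT).
Hypothesis brace : is_skew_brace *%g 1 opp circ one inv.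
Local Notation lam := (lambda circ).
Local Notation ideal := (is_ideal *%g 1 opp circ inv).

Variables (X : {set gT}) (V : {group gT}) (x : gT).
Hypothesis X_ge3 : 3 <= #|X|.
Hypothesis lam_X : forall a, lam a @: X = X.
Hypothesis gen_X : <<X>> = [set: gT].
Hypothesis X_sub : forall y z, y \in X -> z \in X -> y * z^-1 \in V.
Hypothesis V_ideal : ideal V.
Hypothesis V_neq1 : V != [set 1] :> {set gT}.
Hypothesis V_min : forall I, ideal I -> I != [set 1] -> V \subset I.
Hypothesis V_triv : forall a b, (a * b)^-1 * circ a b \in V.
Hypothesis V_trans : forall y z, y \in X -> z \in X ->
  exists a b, [/\ a \in V, b \in V & bsigma *%g opp a (lam b y) = z].
Hypothesis B3_1 : B3 *%g 1 opp circ = [set 1].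
Hypothesis V_abel : {in V &, forall v w, v * w = w * v}.
Hypothesis xX : x \in X.

(** * The action of [V] and the decomposition of the brace *)

Local Notation A := (fun v => x * v * x^-1).
Local Notation A' := (lam x).

(** If [B * B] is zero, every lambda map is trivial. Otherwise minimality puts [V] inside [B * B],
    which acts trivially because [B^(3) = 0]. *)
Lemma lam_V v b : v \in V -> lam v b = b.
Proof.
have [B2_id B2_triv] := B2_ideal brace B3_1.
have [B2_1 _|B2_neq1 vV] := eqVneq (B2 *%g 1 opp circ) [set 1]; last first.
  exact/B2_triv/(subsetP (V_min B2_id B2_neq1)).
have : lam v b * b^-1 \in B2 *%g 1 opp circ.
  by rewrite /B2 add_genE; apply: mem_gen; apply/imset2P; exists v b; rewrite ?in_setT.
by rewrite B2_1 => /set1P/eqP; rewrite -eq_mulgV1 => /eqP.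
Qed.

Lemma V_norm v b : v \in V -> b * v * b^-1 \in V.
Proof. by move=> vV; case/idealP: V_ideal => _ VN _ _; apply: VN. Qed.

Lemma lam_in_V v b : v \in V -> lam b v \in V.
Proof. by move=> vV; case/idealP: V_ideal => _ _ VN _; apply: VN. Qed.

Lemma V_normV v b : v \in V -> b^-1 * v * b \in V.
Proof. by move=> vV; rewrite -{2}[b]invgK V_norm. Qed.

Lemma lam_mulVl v b c : v \in V -> lam (v * b) c = lam b c.
Proof.
move=> vV; have -> : v * b = circ v b by rewrite (circE circ) lam_V.
by rewrite (lam_circ brace) lam_V.
Qed.

(** As [B/V] is trivial, [circ a b] and [a * b] differ by an element of [V]; normality moves it to
    the left, where it acts trivially. So [lam] is a morphism for the additive law as well. *)
Lemma lam_mul a b c : lam (a * b) c = lam a (lam b c).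
Proof.
rewrite -(lam_circ brace) -[circ a b](mulKVg (a * b)).
set w := _ * circ a b; have wV : w \in V by apply: V_triv.
by rewrite -[_ * w](mulgKV (a * b)) (lam_mulVl _ _ (V_norm (a * b) wV)).
Qed.

Lemma lam_expg a i c : lam (a ^+ i) c = iter i (lam a) c.
Proof.
elim: i c => [|i IH] c; first by rewrite (lam_one brace).
by rewrite expgS lam_mul IH.
Qed.

Lemma iter_A i v : iter i A v = x ^+ i * v * x ^- i.
Proof.
elim: i => [|i IH]; first by rewrite expg0 invg1 mulg1 mul1g.
by rewrite iterS IH !expgS invMg !mulgA.
Qed.

Lemma iter_A_V i v : v \in V -> iter i A v \in V.
Proof. by move=> vV; rewrite iter_A V_norm. Qed.

Lemma iter_A'_V i v : v \in V -> iter i A' v \in V.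
Proof. by elim: i => //= i IH vV; rewrite lam_in_V ?IH. Qed.

(** For [b] in [V] the map [lambda_b] is trivial, so the transitive action on [X] is conjugation by
    [V] alone. *)
Lemma X_conj y : y \in X -> exists2 u, u \in V & y = u * x * u^-1.
Proof.
move=> yX; have [a [b [aV bV]]] := V_trans xX yX.
rewrite lam_V // /bsigma => <-; exists a^-1; rewrite ?groupV //.
by rewrite invgK.
Qed.

Lemma lam_x : exists2 u0, u0 \in V & A' x = u0 * x * u0^-1.
Proof. by apply: X_conj; rewrite -(lam_X x) imset_f. Qed.

Lemma V_normal : V <| [set: gT].
Proof.
apply/andP; split; first exact: subsetT.
apply/subsetP=> a _; rewrite inE; apply/subsetP=> _ /imsetP[v vV ->].
by rewrite conjgE mulgA V_normV.
Qed.

Lemma setT_mul : V * <[x]> = [set: gT].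
Proof.
have xN : <[x]> \subset 'N(V).
  exact: subset_trans (subsetT _) (normal_norm V_normal).
apply/eqP; rewrite eqEsubset subsetT -gen_X -norm_joinEr // gen_subG.
apply/subsetP=> y yX; rewrite -[y](mulgKV x) groupM //.
  exact: (subsetP (joing_subl _ _)) (X_sub yX xX).
exact: (subsetP (joing_subr _ _)) (cycle_id x).
Qed.

Lemma decomp a : exists v i, [/\ v \in V, i < #[x] & a = v * x ^+ i].
Proof.
have : a \in V * <[x]> by rewrite setT_mul inE.
by case/mulsgP=> v _ vV /cyclePmin[i ix ->] ->; exists v, i.
Qed.

Lemma lam_decomp v i c : v \in V -> lam (v * x ^+ i) c = iter i A' c.
Proof. by move=> vV; rewrite lam_mulVl // lam_expg. Qed.

(** If [x] centralized [V], its conjugates under [V] would all equal [x], and [X] would be a single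
    point. *)
Lemma A_not_id : ~ {in V, forall v, A v = v}.
Proof.
move=> A1; have X1 : X \subset [set x].
  apply/subsetP=> y /X_conj[u uV ->]; apply/set1P.
  by rewrite -[X in X * x](A1 u uV) mulgKV mulgK.
by have := leq_trans X_ge3 (subset_leq_card X1); rewrite cards1.
Qed.

(** [lambda_x] turns conjugation by [x] into conjugation by [u * x * u^-1], and on the abelian [V]
    the factors [u] have no effect. *)
Lemma A_A'_comm v : v \in V -> A' (A v) = A (A' v).
Proof.
move=> vV; have [u uV xE] := lam_x.
have conjV t w : t \in V -> w \in V -> t * w * t^-1 = w.
  by move=> tV wV; rewrite (V_abel tV wV) mulgK.
rewrite !(lamM brace) (lamV brace) xE.
move: (lam_in_V x vV); move: (lam x v) => w wV.
have -> : u * x * u^-1 * w * (u * x * u^-1)^-1 = u * (x * (u^-1 * w * u^-1^-1) * x^-1) * u^-1.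
  by rewrite !invMg !invgK !mulgA.
by rewrite (conjV u^-1) ?groupV // conjV ?V_norm.
Qed.

(** Writing an element as [v * x ^+ i] with [v] in [V], it conjugates [W] as [A^i] does, because [V]
    is abelian, and its lambda map is [A'^i]. Elements of [W] act trivially, so normality for [circ]
    follows. *)
Lemma submodule_ideal (W : {set gT}) : W \subset V -> is_addsubgroup *%g 1 opp W ->
  A @: W \subset W -> A' @: W \subset W -> ideal W.
Proof.
move=> WV /is_addsubgroupP[W1 WM _] AW A'W.
have memA i w : w \in W -> iter i A w \in W.
  elim: i => // i IH wW; apply: (subsetP AW); apply/imsetP.
  by exists (iter i A w); rewrite ?IH.
have memA' i w : w \in W -> iter i A' w \in W.
  by elim: i => //= i IH wW; apply: (subsetP A'W); apply: imset_f; apply: IH.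
apply: (ideal_of_lam_trivial brace) => [|w wW b|w wW b|w wW b].
- exact/group_setP.
- have [v [i [vV _ ->]]] := decomp b.
  have -> : v * x ^+ i * w * (v * x ^+ i)^-1 = v * iter i A w * v^-1.
    by rewrite iter_A invMg !mulgA.
  by rewrite (V_abel vV) ?(subsetP WV) ?mulgK ?memA.
- by have [v [i [vV _ ->]]] := decomp b; rewrite lam_decomp ?memA'.
- by rewrite lam_V ?(subsetP WV).
Qed.

Lemma V_simple : simple_module_on *%g 1 opp V A A'.
Proof.
split=> // W WV Wgrp AW A'W; have Wid := submodule_ideal WV Wgrp AW A'W.
have [|W_neq1] := eqVneq W [set 1]; first by left.
by right; apply/eqP; rewrite eqEsubset WV V_min.
Qed.

(** * Fixed points in [V] and the additive order of [x] *)

Lemma V_fix f : {in V, forall v, f v \in V} -> {in V &, {morph f : v w / v * w}} ->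
    {in V, forall v, f (A v) = A (f v)} -> {in V, forall v, f (A' v) = A' (f v)} ->
  {in V, forall v, f v = v} \/ {in V, forall v, f v = v -> v = 1}.
Proof.
move=> fV fM fA fA'.
have gG : is_group *%g (1 : gT) opp.
  by split=> [|a|a|a]; [exact: mulgA | rewrite mul1g | rewrite mulg1 | rewrite mulgV mulVg].
apply: (simple_module_fix gG _ V_simple) => // [|v vV|v vV].
- by apply/is_addsubgroupP; split=> [|a b|a]; [exact: group1 | exact: groupM | rewrite groupV].
- exact: V_norm.
- exact: lam_in_V.
Qed.

Lemma A_M : {morph A : v w / v * w}.
Proof. by move=> v w; rewrite !mulgA mulgKV. Qed.

Lemma iter_A_fix j : {in V, forall v, iter j A v = v} \/
  {in V, forall v, iter j A v = v -> v = 1}.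
Proof.
apply: V_fix => [v|v w _ _|v _|v vV].
- exact: iter_A_V.
- by elim: j => // j IH; rewrite !iterS IH A_M.
- by rewrite -iterSr.
- by elim: j => // j IH; rewrite !iterS IH A_A'_comm ?iter_A_V.
Qed.

Lemma iter_A'_fix j : {in V, forall v, iter j A' v = v} \/
  {in V, forall v, iter j A' v = v -> v = 1}.
Proof.
apply: V_fix => [v|v w _ _|v vV|v _].
- exact: iter_A'_V.
- by elim: j => // j IH; rewrite !iterS IH (lamM brace).
- by elim: j => // j IH; rewrite !iterS IH A_A'_comm ?iter_A'_V.
- by rewrite -iterSr.
Qed.

Lemma A_fix v : v \in V -> A v = v -> v = 1.
Proof.
by case: (iter_A_fix 1) => [A1|A1]; [case: A_not_id | apply: A1].
Qed.

(** A power of [x] commutes with [x], hence is fixed by [A]; inside [V] only [1] is. *)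
Lemma V_cap_x : V :&: <[x]> = 1.
Proof.
apply/trivgP/subsetP=> v /setIP[vV /cycleP[i vE]]; apply/set1P/A_fix => //.
by rewrite vE -expgS expgSr mulgK.
Qed.

Lemma order_x : #|[set [set a * v | v in V] | a in [set: gT]]| = #[x].
Proof.
have -> : #|[set [set a * v | v in V] | a in [set: gT]]| = #|[set: gT] : V|.
  exact: (card_lcosets [set: gT] V).
have cardT : #|[set: gT]| = (#|V| * #[x])%N by rewrite -setT_mul (TI_cardMg V_cap_x).
have := Lagrange (subsetT V); rewrite cardT.
by move/eqP; rewrite eqn_pmul2l ?cardG_gt0 // => /eqP.
Qed.

Lemma order_x_gt1 : 1 < #[x].
Proof.
rewrite ltn_neqAle order_gt0 andbT eq_sym order_eq1.
apply/eqP=> x1; apply: A_not_id => v _ /=.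
by rewrite x1 mul1g invg1 mulg1.
Qed.

Lemma lam_id_of (f : gT -> gT) : {morph f : a b / a * b} ->
  {in V, forall v, f v = v} -> f x = x -> forall a, f a = a.
Proof.
move=> fM fV fx a; have [v [i [vV _ ->]]] := decomp a.
rewrite fM fV //; congr (_ * _); elim: i => [|i IH]; first by rewrite expg0 fV.
by rewrite expgS fM fx IH.
Qed.

(* The subgroup generated by [x ^+ m] is then an ideal meeting [V] trivially. *)
Lemma order_x_dvd m : {in V, forall v, iter m A v = v} ->
  (forall a, iter m A' a = a) -> #[x] %| m.
Proof.
move=> Am A'm; set z := x ^+ m.
have [u uV xE] := lam_x.
have zV v : v \in V -> z * v = v * z.
  by move=> /Am; rewrite iter_A => {2}<-; rewrite mulgKV.
have zx : z * x = x * z by rewrite -expgS expgSr.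
(* [lambda_x] sends [x] to its conjugate by [u], hence [z] to its conjugate by [u], which is [z]
   because [z] centralizes [V]. *)
have A'z : A' z = z.
  rewrite (lamX brace) xE.
  have -> : (u * x * u^-1) ^+ m = u * z * u^-1.
    have conjE t : u * t * u^-1 = t ^ u^-1 by rewrite conjgE invgK mulgA.
    by rewrite !conjE conjXg.
  by rewrite -zV // mulgK.
have z_ideal : ideal <[z]>.
  apply: (ideal_of_lam_trivial brace) => [|a aZ b|a aZ b|a aZ b]; first exact: groupP.
  - have /centP cz : b \in 'C(<[z]>).
      rewrite cent_cycle; apply/cent1P.
      have [v [i [vV _ ->]]] := decomp b; rewrite /commute.
      by rewrite [RHS]mulgA zV // /z -!mulgA -!expgnDr addnC.
    by rewrite (cz a aZ) mulgK.
  - have [v [i [vV _ ->]]] := decomp b; rewrite lam_decomp //.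
    have /cycleP[j ->] := aZ; suff -> : iter i A' (z ^+ j) = z ^+ j by apply: mem_cycle.
    by elim: i => // i IH; rewrite iterS IH (lamX brace) A'z.
  - have /cycleP[j ->] := aZ; rewrite lam_expg; elim: j => // j IH.
    by rewrite iterS IH lam_expg A'm.
(* If [z] were non-trivial, minimality would put [V] inside [<[z]>], hence inside [<[x]>], against
   [V_cap_x]. *)
rewrite order_dvdn -/z; apply/idPn=> z_neq1.
have Vz : V \subset <[z]> by apply: V_min => //; rewrite cycle_eq1.
have : V \subset V :&: <[x]>.
  by rewrite subsetI subxx (subset_trans Vz) // cycle_subG mem_cycle.
rewrite V_cap_x => V1; case/eqP: V_neq1.
by apply/eqP; rewrite eqEsubset V1 sub1G.
Qed.

(** For a prime [p] dividing [#|V|], the elements killed by [p] form a submodule, non-zero by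
    Cauchy, hence equal to [V]. Cauchy again excludes any other prime divisor. *)
Lemma V_elem_abelian : exists p n, elem_abelian *%g 1 opp V p n.
Proof.
have V_gt1 : 1 < #|V| by rewrite cardG_gt1.
pose p := pdiv #|V|; have p_pr : prime p by apply: pdiv_prime.
have p_dvd : p %| #|V| by apply: pdiv_dvd.
have Vp : {in V, forall v, v ^+ p = 1}.
  have [_ Vsimple] := V_simple; pose W := [set v in V | v ^+ p == 1].
  case: (Vsimple W) => [||||W1|WV].
  - by apply/subsetP=> v; rewrite inE => /andP[].
  - apply/is_addsubgroupP; split=> [|v w|v]; rewrite !inE ?group1 ?expg1n ?eqxx //.
      move=> /andP[vV /eqP vp] /andP[wV /eqP wp]; rewrite groupM //.
      by rewrite (expgMn _ (V_abel vV wV)) vp wp mulg1 eqxx.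
    by move=> /andP[vV /eqP vp]; rewrite groupV vV expgVn vp invg1 eqxx.
  - apply/subsetP=> _ /imsetP[v /[!inE] /andP[vV /eqP vp] ->].
    by rewrite V_norm // -{1}[x]invgK -mulgA -conjgE -conjXg vp conj1g eqxx.
  - apply/subsetP=> _ /imsetP[v /[!inE] /andP[vV /eqP vp] ->].
    by rewrite lam_in_V // -(lamX brace) vp (lam1 brace) eqxx.
  - have [v vV ov] := Cauchy p_pr p_dvd.
    have : v \in W by rewrite inE vV -order_dvdn ov dvdnn.
    by rewrite W1 => /set1P v1; rewrite -ov v1 order1 in p_pr.
  - by move=> v; rewrite -{1}WV inE => /andP[_ /eqP].
have pV : p.-group V.
  apply/pgroupP=> q q_pr /(Cauchy q_pr)[v vV ov].
  by rewrite inE /= -dvdn_prime2 // -ov order_dvdn Vp.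
exists p, (logn p #|V|); split=> //.
- by rewrite logn_gt0 mem_primes p_pr cardG_gt0.
- by apply/is_addsubgroupP; split=> [|a b|a]; [exact: group1 | exact: groupM | rewrite groupV].
- split; first exact: card_pgroup.
  by move=> v vV; rewrite iter_mulg_1 Vp.
Qed.

(** * The orders of [A] and [A'] on [V] *)

Lemma V_nontrivial : exists2 v0, v0 \in V & v0 != 1.
Proof.
by have /trivgPn[v vV v1] : (V :!=: 1); [exact: V_neq1 | exists v].
Qed.

Lemma A_order : exists2 o, order_on V A o & o %| #|V| - 1.
Proof.
have [v0 v0V v0_neq1] := V_nontrivial.
apply: (order_on_dvd (zero := 1) (v0 := v0)) => //=; last exact: iter_A_fix.
- by move=> v w /mulIg/mulgI.
- by move=> v; apply: V_norm.
- by rewrite mulg1 mulgV.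
Qed.

Lemma A'_order : exists2 o, order_on V A' o & o %| #|V| - 1.
Proof.
have [v0 v0V v0_neq1] := V_nontrivial.
apply: (order_on_dvd (zero := 1) (v0 := v0)) => //=; last exact: iter_A'_fix.
- exact: lam_inj brace _.
- by move=> v; apply: lam_in_V.
- exact: (lam1 brace).
Qed.

Lemma iter_order_A v : iter #[x] A v = v.
Proof. by rewrite iter_A expg_order mul1g invg1 mulg1. Qed.

Lemma iter_order_A' a : iter #[x] A' a = a.
Proof. by rewrite -lam_expg expg_order (lam_one brace). Qed.

Lemma iter_A'_M i : {morph iter i A' : a b / a * b}.
Proof. by elim: i => // i IH a b; rewrite !iterS IH (lamM brace). Qed.

(** * The exact value of [k] *)

Section BasePoint.
Variable u0 : gT.
Hypotheses (u0V : u0 \in V) (A'x : A' x = u0 * x * u0^-1).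

Lemma A'_x : A' x = u0 * (A u0)^-1 * x.
Proof. by rewrite A'x !invMg invgK !mulgA mulgKV. Qed.

Lemma A'_decomp v i : A' (v * x ^+ i) = A' v * u0 * (iter i A u0)^-1 * x ^+ i.
Proof.
rewrite (lamM brace) (lamX brace) A'x iter_A.
have -> : (u0 * x * u0^-1) ^+ i = u0 * x ^+ i * u0^-1.
  have conjE t : u0 * t * u0^-1 = t ^ u0^-1 by rewrite conjgE invgK mulgA.
  by rewrite !conjE conjXg.
by rewrite !invMg invgK !mulgA mulgKV.
Qed.

(** With [A'] trivial on [V], the [i]-th iterate of [lambda_x] sends [x] to [v1 ^+ i * x], so it is
    the identity exactly when [v1 ^+ i = 1]. If [v1] is non-trivial it has order [p], whence [p]
    divides [#[x]], and coprimality gives [p * oA]. *)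
Lemma order_A'1 oA p : {in V, forall v, A' v = v} -> order_on V A oA ->
    {in V, forall v, v ^+ p = 1} -> prime p -> coprime p oA ->
  [/\ u0 * (A u0)^-1 = 1 -> #[x] = oA & u0 * (A u0)^-1 <> 1 -> #[x] = (p * oA)%N].
Proof.
move=> A'1 ordA Vp p_pr cop; have [_ oAP _] := ordA.
have oA_dvd : oA %| #[x] by apply: order_on_min ordA _ => v _; apply: iter_order_A.
set v1 := u0 * _; have v1V : v1 \in V by rewrite groupM ?groupV ?V_norm.
have iterA'1 i : {in V, forall v, iter i A' v = v}.
  by elim: i => // i IH v vV; rewrite iterS IH ?A'1.
have iterx i : iter i A' x = v1 ^+ i * x.
  elim: i => [|i IH]; first by rewrite mul1g.
  by rewrite iterS IH (lamM brace) A'1 ?groupX // A'_x -/v1 expgSr mulgA.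
have dvd m : oA %| m -> v1 ^+ m = 1 -> #[x] %| m.
  move=> oAm v1m; apply: order_x_dvd => [v vV|].
    exact: iter_dvd oAm (oAP v vV).
  apply: lam_id_of; [exact: iter_A'_M | exact: iterA'1 |].
  by rewrite iterx v1m mul1g.
split=> [v1_1|/eqP v1_neq1]; apply/eqP; rewrite eqn_dvd; apply/andP; split=> //.
- by apply: dvd => //; rewrite v1_1 expg1n.
- by apply: dvd; rewrite ?dvdn_mull // expgM Vp // expg1n.
- rewrite Gauss_dvd // oA_dvd andbT.
  rewrite -(nt_prime_order p_pr (Vp v1 v1V) v1_neq1) order_dvdn.
  by apply/eqP/(mulIg x); rewrite -iterx iter_order_A' mul1g.
Qed.

(** For [m] the least common multiple, [lambda_x^m] fixes [V] and sends [x] to [w * x] with [w] in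
    [V]. Commuting with [lambda_x] forces [A' w = w], so [w = 1] because [A'] is not the identity;
    [order_x_dvd] then applies to [m]. *)
Lemma order_A'_neq1 oA oP : ~ {in V, forall v, A' v = v} ->
    order_on V A oA -> order_on V A' oP ->
  #[x] = lcmn oA oP.
Proof.
move=> A'_neq1 ordA ordP; have [_ oAP _] := ordA; have [_ oPP _] := ordP.
have oA_dvd : oA %| #[x] by apply: order_on_min ordA _ => v _; apply: iter_order_A.
have oP_dvd : oP %| #[x] by apply: order_on_min ordP _ => v _; apply: iter_order_A'.
apply/eqP; rewrite eqn_dvd dvdn_lcm oA_dvd oP_dvd !andbT; set m := lcmn oA oP.
have A'm v : v \in V -> iter m A' v = v.
  by move=> vV; apply: iter_dvd (dvdn_lcmr _ _) (oPP v vV).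
apply: order_x_dvd => [v vV|]; first exact: iter_dvd (dvdn_lcml _ _) (oAP v vV).
apply: lam_id_of => //; first exact: iter_A'_M.
have [w wV mx] : exists2 w, w \in V & iter m A' x = w * x.
  exists (iter m A' x * x^-1); last by rewrite mulgKV.
  apply: X_sub => //; elim: m {A'm} => // i IH.
  by rewrite iterS -(lam_X x) imset_f.
suff w1 : w = 1 by rewrite mx w1 mul1g.
have A'w : A' w = w.
  have v1V : u0 * (A u0)^-1 \in V by rewrite groupM ?groupV ?V_norm.
  have := iterSr m A' x; rewrite iterS mx (lamM brace) A'_x iter_A'_M A'm // mx.
  by rewrite [RHS]mulgA (V_abel v1V wV) -[RHS]mulgA => /mulIg.
by case: (iter_A'_fix 1) => [A'1|/(_ w wV A'w)]; first by case: A'_neq1.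
Qed.

End BasePoint.

(** * Assembling the converse *)

Lemma converse (k := #|[set [set a * v | v in V] | a in [set: gT]]|) :
  exists p n,
    [/\ 1 < k, elem_abelian *%g 1 opp V p n, add_order *%g 1 x k,
        sdp_decomp *%g 1 V x k &
        forall u0, u0 \in V -> A' x = u0 * x * u0^-1 ->
          [/\ hypA *%g 1 opp V p n k A A' u0,
              forall v i, v \in V -> i < k ->
                lam (v * iter i ( *%g x) 1) =1 iter i A' &
              forall v i, v \in V -> i < k ->
                A' (v * iter i ( *%g x) 1) =
                A' v * u0 * (iter i A u0)^-1 * iter i ( *%g x) 1]].
Proof.
have [p [n Vab]] := V_elem_abelian; exists p, n; rewrite /k order_x.
have [p_pr n_gt0 _ _ [cardV Vp]] := Vab.
have {}Vp : {in V, forall v, v ^+ p = 1} by move=> v /Vp; rewrite iter_mulg_1.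
split=> //.
- exact: order_x_gt1.
- split; rewrite ?order_gt0 ?iter_mulg_1 ?expg_order // => j /andP[j_gt0 j_lt].
  rewrite iter_mulg_1 => /eqP; rewrite -order_dvdn => /(dvdn_leq j_gt0).
  by rewrite leqNgt j_lt.
- split=> [a|v w i j vV wV ik jk].
    have [v [i [vV ik ->]]] := decomp a; exists v, i.
    by rewrite iter_mulg_1.
  rewrite !iter_mulg_1 => eq_vw.
  have eq_wv : w^-1 * v = x ^+ j * x ^- i.
    by apply: (mulgI w); apply: (mulIg (x ^+ i)); rewrite mulKVg mulgA mulgKV.
  have : w^-1 * v \in V :&: <[x]>.
    by rewrite inE groupM ?groupV // eq_wv groupM ?groupV ?mem_cycle.
  rewrite V_cap_x => /set1P wv1; move: eq_wv; rewrite wv1 => /esym/eqP.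
  rewrite -eq_mulgV1 eq_expg_mod_order !modn_small // => /eqP ->; split=> //.
  by rewrite -[v](mulKVg w) wv1 mulg1.
- move=> u0 u0V A'x; split; last 2 first.
  + by move=> v i vV _ c; rewrite iter_mulg_1 lam_decomp.
  + by move=> v i vV _; rewrite iter_mulg_1 (A'_decomp A'x).
  split.
  + by split; [exact: Vab | exact: order_x_gt1].
  + split; [|split].
    * split=> [v w _ _ /mulIg/mulgI //||v w _ _]; last exact: A_M.
      apply: in_imset_surj => [v w _ _ /mulIg/mulgI // | v]; exact: V_norm.
    * split=> [v w _ _ /(lam_inj brace) //||v w _ _]; last exact: (lamM brace).
      apply: in_imset_surj => [v w _ _ /(lam_inj brace) // | v]; exact: lam_in_V.
    * by move=> v vV; rewrite A_A'_comm.
  + by split=> // A1; apply: A_not_id.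
  + have [oA ordA dA] := A_order; have [oP ordP dP] := A'_order.
    exists oA, oP; rewrite !dvdn_gcd -cardV dA dP !andbT; split=> //.
    * by apply: order_on_min ordA _ => v _; apply: iter_order_A.
    * by apply: order_on_min ordP _ => v _; apply: iter_order_A'.
    (* [oA] divides [#|V| - 1], while [p] divides [#|V|]. *)
    have cop : coprime p oA.
      rewrite prime_coprime //; apply/negP=> p_oA.
      have p_dvd : p %| #|V| by rewrite cardV dvdn_exp.
      have := dvdn_sub p_dvd (dvdn_trans p_oA dA).
      rewrite subKn ?cardG_gt0 // dvdn1 => /eqP p1.
      by rewrite p1 in p_pr.
    split=> A'1.
    * by have [+ _] := order_A'1 u0V A'x A'1 ordA Vp p_pr cop; apply.
    * by have [_ +] := order_A'1 u0V A'x A'1 ordA Vp p_pr cop; apply.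
    * exact: (order_A'_neq1 u0V A'x A'1 ordA ordP).
  + exact: V_simple.
Qed.

End Converse.

(** * Transfer to the unbundled structures *)

Theorem theorem5p7 :
  (* (a) the construction *)
  (forall (VT : finType) (addV : VT -> VT -> VT) (zeroV : VT) (oppV : VT -> VT)
          (p n k : nat) (A A' : VT -> VT) (u0 : VT) (hk : 1 < k),
     is_group addV zeroV oppV -> commutative addV ->
     hypA addV zeroV oppV [set: VT] p n k A A' u0 ->
     let o : 'I_k := Ordinal (ltnW hk) in
     let x : VT * 'I_k := (zeroV, Ordinal hk) in
     let addB := sdp_add addV A (k := k) in
     let circB := sdp_circ addV oppV A A' u0 (k := k) in
     let v1 := addV u0 (oppV (A u0)) in
     exists (zeroB : VT * 'I_k) (oppB : VT * 'I_k -> VT * 'I_k)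
            (oneB : VT * 'I_k) (invB : VT * 'I_k -> VT * 'I_k),
       is_skew_brace addB zeroB oppB circB oneB invB /\
       let r := brB addB oppB circB invB in
       let X := [set addB (addB (v, o) x) (oppB (v, o)) | v : VT] in
       [/\ X = [set addB (v, o) x | v : VT],
           r @: setX X X = setX X X,
           solution_on X r /\ nondegenerate_on X r,
           irretractable_on X r /\ simple_on X r &
           forall v w : VT,
             r (addB (v, o) x, addB (w, o) x) =
             (addB (addV (A' w) v1, o) x,
              addB (addV (addV (oppV (finv A w))
                                (finv (A \o A') (addV v (oppV v1)))) w, o) x)])
  /\
  (* (b) the converse *)
  (forall (T : finType) (add : T -> T -> T) (zero : T) (opp : T -> T)
          (circ : T -> T -> T) (one : T) (inv : T -> T)
          (X V : {set T}) (x : T),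
     is_skew_brace add zero opp circ one inv ->
     (* standing assumptions *)
     3 <= #|X| ->
     (forall a, blam add opp circ a @: X = X) ->
     (forall a, bsigma add opp a @: X = X) ->
     add_gen add zero opp X = [set: T] ->
     V = ideal_gen add zero opp circ inv [set add y (opp z) | y in X, z in X] ->
     V != [set zero] ->
     (forall I, is_ideal add zero opp circ inv I -> I != [set zero] -> V \subset I) ->
     (forall a b, add (opp (add a b)) (circ a b) \in V) ->
     (exists g, forall a, exists i, add (opp (iter i (add g) zero)) a \in V) ->
     (forall y z, y \in X -> z \in X ->
        exists a b, [/\ a \in V, b \in V &
                        bsigma add opp a (blam add opp circ b y) = z]) ->
     B3 add zero opp circ = [set zero] ->
     simple_on X (brB add opp circ inv) ->
     (* V abelian *)
     (forall v w, v \in V -> w \in V -> add v w = add w v) ->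
     x \in X ->
     let k := #|[set [set add a v | v in V] | a in [set: T]]| in
     let A := fun v => add (add x v) (opp x) in
     let A' := blam add opp circ x in
     let xi := fun i => iter i (add x) zero in
     (exists2 u0, u0 \in V & A' x = add (add u0 x) (opp u0)) /\
     exists p n,
       [/\ 1 < k, elem_abelian add zero opp V p n,
           add_order add zero x k, sdp_decomp add zero V x k &
           forall u0, u0 \in V -> A' x = add (add u0 x) (opp u0) ->
             [/\ hypA add zero opp V p n k A A' u0,
                 forall v i, v \in V -> i < k ->
                   blam add opp circ (add v (xi i)) =1 iter i A' &
                 forall v i, v \in V -> i < k ->
                   A' (add v (xi i)) =
                   add (add (add (A' v) u0) (opp (iter i A u0))) (xi i)]]).
Proof.
split.
(* [Finite] records have no eta rule, so the structure of the alias is convertible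
   to the original one only once the latter is destructed. *)
- move=> [VT cVT] addV zeroV oppV p n k A A' u0 hk addG addC hyp.
  have [_ [[_ _ AD] [[_ _ A'D] _]] _ _ _] := hyp.
  pose V : finZmodType := add_zmod addG addC.
  have [gA gAE] := @additive_of V A (fun v w => AD v w (in_setT _) (in_setT _)).
  have [gP gPE] := @additive_of V A' (fun v w => A'D v w (in_setT _) (in_setT _)).
  move: hyp; rewrite -gAE -gPE => hyp.
  have H := @construction V p n k gA gP u0 hk hyp.
  exact H.
- move=> [T cT] add zero opp circ one inv X V x brace X_ge3 lam_X _ gen_X VE.
  move=> V_neq1 V_min V_triv _ V_trans B3_1 _ V_abel xX k A A' xi.
  have addG : is_group add zero opp by case: brace.
  pose gT : finGroupType := add_fingroup addG.
  have V_ideal : is_ideal add zero opp circ inv V.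
    rewrite VE; exact: (@ideal_gen_ideal gT circ inv).
  have [Vgrp _ _ _] := @idealP gT circ inv V V_ideal.
  pose VG : {group gT} := Group Vgrp.
  have X_sub (y z : gT) : y \in X -> z \in X -> add y (opp z) \in VG.
    move=> yX zX; have VGE : VG = V :> {set gT} by [].
    rewrite VGE VE; apply: (subsetP (@sub_ideal_gen gT circ inv _)).
    by apply/imset2P; exists y z.
  have gen_X' : <<(X : {set gT})>>%g = setT by rewrite -add_genE.
  split.
    exact: (@lam_x gT circ one inv brace X VG x).
  exact: (@converse gT circ one inv brace X VG x).
Qed.
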